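(* Let $A \ge 2$ be an integer. There exists an arithmetic progression of odd positive integers $k$ such that, for every $k$ in the progression, $k\cdot a^n + 1$ is composite for all integers $a\in[2,A]$ and all $n\in\mathbb{Z}^+$.
   Context: An arithmetic progression of positive integers means an infinite set of the form $\{U + mV : m \in \mathbb{Z}_{\ge 0}\}$ with $U, V$ positive integers. $\mathbb{Z}^+$ denotes the set of positive integers. *)

(* Defs.v *)
From mathcomp Require Import all_boot.

Set Implicit Arguments.
Unset Strict Implicit.
Unset Printing Implicit Defensive.

Definition composite (n : nat) : bool := (1 < n) && ~~ prime n.

Definition arith_prog (U V : nat) (k : nat) : Prop :=
  exists m : nat, k = U + m * V.

(* Main.v *)
(** Every odd [a] is harmless because [k * a ^ n + 1] is even.  For even [a], a
    prime divisor of [a ^ (2 ^ i) + 1] at which [k] is [1] takes care of all [n]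
    with 2-adic valuation [i]; doing this for all [i <= T] leaves the multiples
    of [2 ^ T.+1].  For these the base is effectively [b = a ^ (2 ^ T.+1)], and,
    for each [e], the primes at which [a] has order [2 ^ j.+2 * 3 ^ e.+1] with
    [j < T] all give [b] the same order [3 ^ e.+1].  So [3 ^ e.+1] of them,
    one for each residue of the exponent modulo [3 ^ e.+1], cover what is left.

    These primes must avoid those already forced to have residue [1], of which
    there are at most [A * T.+1] (up to the prime [2]).  With [A.+1] values of
    [e], each even [a <= A] has [A.+1 * T] distinct candidates, so for large [T]
    the pigeonhole principle yields an [e] with enough free primes, even after
    the bounded number of primes used for other bases is discarded. *)
Require Import Defs.
From mathcomp Require Import all_boot.
From mathcomp Require Import zify.

(** * Powers modulo an integer, simultaneous congruences, counting *)

Lemma sqr_modn1 (x p : nat) : p %| x + 1 -> x ^ 2 = 1 %[mod p].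
Proof.
case: x => [|x] px; first by move: px; rewrite add0n dvdn1 => /eqP ->; rewrite !modn1.
apply/eqP; rewrite eqn_mod_dvd ?expn_gt0 //.
by rewrite -[1]/(1 ^ 2) subn_sqr dvdn_mull.
Qed.

Lemma expn_modn1 (x p n : nat) : x = 1 %[mod p] -> x ^ n = 1 %[mod p].
Proof. by move=> x1; rewrite -modnXm x1 modnXm exp1n. Qed.

Lemma expn_modn1_dvd (x p m n : nat) :
  m %| n -> x ^ m = 1 %[mod p] -> x ^ n = 1 %[mod p].
Proof. by case/dvdnP=> q ->; rewrite mulnC expnM; apply: expn_modn1. Qed.

Lemma dvdn_expD1_odd (x p n : nat) : odd n -> p %| x + 1 -> p %| x ^ n + 1.
Proof.
move=> on px; rewrite -(odd_double_half n) on add1n expnS -mul2n expnM.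
rewrite /dvdn -modnDml -modnMmr (expn_modn1 _ _ _ (sqr_modn1 _ _ px)).
by rewrite modnMmr modnDml muln1.
Qed.

Lemma chinese_seq (s : seq nat) (rho : nat -> nat) :
    uniq s -> all prime s ->
  exists k : nat, forall p : nat, p \in s -> k = rho p %[mod p].
Proof.
elim: s => [|p s IHs] /=; first by exists 0.
case/andP=> ps us /andP[pp prs]; have [k Hk] := IHs us prs.
have co : coprime p (\prod_(q <- s) q).
  rewrite big_seq; elim/big_rec: _ => [|q x qs cox]; first exact: coprimen1.
  rewrite coprimeMr cox andbT prime_coprime // dvdn_prime2 // ?(allP prs) //.
  by apply: contraNneq ps => ->.
exists (chinese p (\prod_(q <- s) q) (rho p) k) => q; rewrite inE.
case/predU1P=> [->|qs]; first exact: chinese_modl.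
have qP : q %| \prod_(r <- s) r by rewrite (big_rem q) //= dvdn_mulr.
rewrite -(Hk _ qs) -(modn_dvdm (chinese _ _ _ _) qP) chinese_modr //.
exact: modn_dvdm.
Qed.

(** Otherwise each of the [E] rows has at most [M] values outside [X], and the [E * T] distinct
    values of [g] number at most [size X + E * M]. *)
Lemma pigeonhole_avoid (g : nat -> nat -> nat) (X : seq nat) (E T M : nat) :
    (forall e e' j j', g e j = g e' j' -> e = e' /\ j = j') ->
    size X + E * M < E * T ->
  exists2 e, e < E & M <= count [predC X] [seq g e j | j <- iota 0 T].
Proof.
move=> ginj ltXT.
case: (altP (@hasP _ (fun e => M <= count [predC X] [seq g e j | j <- iota 0 T])
                   (iota 0 E))).
  by case=> e; rewrite mem_iota => ltE leM; exists e.
rewrite -all_predC => /allP few; exfalso.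
pose L := [seq g e j | e <- iota 0 E, j <- iota 0 T].
have uL : uniq L.
  by apply: allpairs_uniq; rewrite ?iota_uniq // => -[e j] [e' j'] _ _ /= /ginj[-> ->].
have sL : size L = E * T by rewrite size_allpairs !size_iota.
have inX : count (mem X) L <= size X.
  rewrite -size_filter; apply: uniq_leq_size; first exact: filter_uniq.
  by move=> x; rewrite mem_filter => /andP[].
have outX : count [predC X] L <= E * M.
  rewrite /L count_flatten -map_comp -[E in E * M](size_iota 0).
  elim: (iota 0 E) few => //= e es IH few.
  rewrite mulSn leq_add ?IH //.
    by have := few e (mem_head _ _); rewrite /= -ltnNge => /ltnW.
  by move=> e' e's; apply: few; rewrite inE e's orbT.
have := count_predC (mem X) L; rewrite sL => eqL.
have : E * T <= size X + E * M by rewrite -eqL leq_add.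
by rewrite leqNgt ltXT.
Qed.

(* The divided number is the sixth cyclotomic polynomial at a power of [a], so
   that [a] has order [2 ^ j.+2 * 3 ^ e.+1] at this prime when [a] is even. *)
Definition order_prime (a e j : nat) : nat :=
  let y := a ^ (2 ^ j.+1 * 3 ^ e) in pdiv (y * y.-1 + 1).

(** * Multiplicative orders of an even base *)

Section OrderPrime.

Variable a : nat.
Hypotheses (a_gt1 : 1 < a) (a_even : ~~ odd a).

Lemma order_base_gt1 (e j : nat) : 1 < a ^ (2 ^ j.+1 * 3 ^ e).
Proof.
by apply: leq_trans a_gt1 _; rewrite -{1}(expn1 a) leq_exp2l // muln_gt0 !expn_gt0.
Qed.

Lemma order_prime_dvd_cyclotomic (e j : nat) :
  let y := a ^ (2 ^ j.+1 * 3 ^ e) in order_prime a e j %| y * y.-1 + 1.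
Proof. exact: pdiv_dvd. Qed.

Lemma order_prime_prime (e j : nat) : prime (order_prime a e j).
Proof. by apply: pdiv_prime; have := order_base_gt1 e j; nia. Qed.

Lemma order_prime_odd (e j : nat) : odd (order_prime a e j).
Proof.
apply: (dvdn_odd (order_prime_dvd_cyclotomic e j)).
by rewrite oddD oddM oddX (negbTE a_even) muln_eq0 !expn_eq0.
Qed.

Lemma order_prime_dvd (e j : nat) :
  order_prime a e j %| a ^ (2 ^ j.+1 * 3 ^ e.+1) + 1.
Proof.
rewrite (expnSr 3) mulnA expnM.
apply: dvdn_trans (order_prime_dvd_cyclotomic e j) _ => /=.
have := order_base_gt1 e j; set y := a ^ _ => y_gt1.
(* Factorization [y ^ 3 + 1 = (y + 1) * (y ^ 2 - y + 1)]. *)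
apply/dvdnP; exists (y + 1); case: y y_gt1 => // y _ /=; rewrite !expnS expn0; nia.
Qed.

(** Let [y] be the power of [a] used in [order_prime]. If [y ^ 2 = 1], then either [y = 1] and the
    prime divides 1, or [y = -1] and the prime is 3; but [y] is a square and -1 is not one modulo
    3. *)
Lemma order_prime_neq1 (e j : nat) :
  a ^ (2 ^ j.+2 * 3 ^ e) != 1 %[mod order_prime a e j].
Proof.
have := order_prime_prime e j; have := order_prime_dvd_cyclotomic e j => /=.
have := order_base_gt1 e j.
rewrite (expnS 2 j.+1) -mulnA (mulnC 2) [a ^ (_ * 2)]expnM.
have : a ^ (2 ^ j.+1 * 3 ^ e) = (a ^ (2 ^ j * 3 ^ e)) ^ 2.
  by rewrite -expnM expnS -mulnA mulnC.
move: (a ^ (2 ^ j * 3 ^ e)) (a ^ _) (order_prime a e j) => x y p yx y_gt1 pd pp.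
rewrite eqn_mod_dvd ?expn_gt0 ?(ltnW y_gt1) // -{2}(exp1n 2) subn_sqr.
rewrite Euclid_dvdM //; apply/norP; split; apply/negP => py.
  move: pd; rewrite dvdn_addr; last by rewrite dvdn_mull // -subn1.
  by rewrite dvdn1 => /eqP p1; rewrite p1 in pp.
have p3 : p %| 3.
  have -> : 3 = (y * y.-1 + 1) - (y + 1) * (y - 2) by case: y y_gt1 {yx pd py} => [|[]] //=; nia.
  by rewrite dvdn_sub // dvdn_mulr.
move: p3; rewrite (@dvdn_prime2 p 3) // => /eqP p3.
move: py; rewrite p3 yx /dvdn -modnDml -modnXm.
have : x %% 3 < 3 by rewrite ltn_mod.
by case: (x %% 3) => [|[|[]]].
Qed.

Lemma order_prime_expn1 (e j m : nat) :
  2 ^ j.+2 * 3 ^ e.+1 %| m -> a ^ m = 1 %[mod order_prime a e j].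
Proof.
move/expn_modn1_dvd; apply.
by rewrite (expnS 2 j.+1) -mulnA mulnC expnM sqr_modn1 // order_prime_dvd.
Qed.

(** If [j < j'], an odd power of -1 would be 1 modulo an odd prime. Once [j = j'], having [e < e']
    contradicts [order_prime_neq1]. *)
Lemma order_prime_inj (e e' j j' : nat) :
  order_prime a e j = order_prime a e' j' -> e = e' /\ j = j'.
Proof.
have jle f f' i i' : order_prime a f i = order_prime a f' i' -> i' <= i.
  move=> eqp; rewrite leqNgt; apply/negP => lti.
  have := dvdn_expD1_odd _ _ (3 ^ f.+1) _ (order_prime_dvd f' i').
  rewrite -eqp oddX orbT => /(_ isT); rewrite -expnM.
  rewrite /dvdn -modnDml order_prime_expn1; last first.
    by rewrite dvdn_mul // dvdn_mulr // dvdn_exp2l.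
  rewrite modnDml -/(_ %| _) dvdn_prime2 ?order_prime_prime // => /eqP p2.
  by have := order_prime_odd f i; rewrite p2.
have ele : forall f f' i, order_prime a f i = order_prime a f' i -> f' <= f.
  move=> f f' i eqp; rewrite leqNgt; apply/negP => lti.
  have := order_prime_neq1 f' i; rewrite -eqp => /eqP; apply.
  by rewrite order_prime_expn1 // dvdn_mul // dvdn_exp2l.
move=> eqp; have ej : j = j'.
  by apply/eqP; rewrite eqn_leq (jle _ _ _ _ eqp) (jle _ _ _ _ (esym eqp)).
move: eqp; rewrite ej => eqp; split=> //.
by apply/eqP; rewrite eqn_leq (ele _ _ _ eqp) (ele _ _ _ (esym eqp)).
Qed.

End OrderPrime.

(** * Covering the exponents by residue classes *)

Lemma covering_residues (b m : nat) (ps : seq nat) :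
    0 < m -> uniq ps -> all prime ps -> size ps = m ->
    (forall p, p \in ps -> b ^ m = 1 %[mod p]) ->
  exists rho : nat -> nat, forall k : nat,
    (forall p, p \in ps -> k = rho p %[mod p]) ->
    forall q : nat, exists2 p, p \in ps & p %| k * b ^ q + 1.
Proof.
move=> m0 ups prps szps ordb.
(* At the prime of index [r] this is [-b ^ (-r)], so [k * b ^ q = -1] there as soon as [q] is [r]
   modulo [m]. *)
exists (fun p => p.-1 * b ^ (m - index p ps)) => k Hk q.
have ltr : q %% m < m by rewrite ltn_mod.
have pin : nth 0 ps (q %% m) \in ps by rewrite mem_nth ?szps.
exists (nth 0 ps (q %% m)) => //.
have := Hk _ pin; rewrite index_uniq ?szps //.
move: (nth 0 ps _) pin => p pin kp.
have bq : b ^ (m - q %% m + q) = 1 %[mod p].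
  apply: (expn_modn1_dvd _ _ m) (ordb p pin).
  rewrite {2}(divn_eq q m) addnCA subnK 1?ltnW //.
  by rewrite dvdn_add ?dvdn_mull.
rewrite /dvdn -modnDml -modnMml kp modnMml -mulnA -expnD.
rewrite -modnMmr bq modnMmr muln1 modnDml addn1 prednK ?modnn //.
exact/prime_gt0/(allP prps).
Qed.

(** [D] lists forbidden primes. Bases are treated one at a time, primes already used being forbidden
    too, so residues never conflict; the bound on [size s] keeps the pigeonhole count valid. *)
Lemma covering_primes (E T : nat) (D bs : seq nat) :
    all (fun a => (1 < a) && ~~ odd a) bs ->
    size D + size bs * 3 ^ E + E * 3 ^ E < E * T ->
  exists (s : seq nat) (rho : nat -> nat),
    [/\ uniq s, all prime s, all [predC D] s, size s <= size bs * 3 ^ E &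
      forall k, (forall p, p \in s -> k = rho p %[mod p]) ->
      forall a, a \in bs -> forall q : nat,
        exists2 p, p \in s & p %| k * (a ^ 2 ^ T.+1) ^ q + 1].
Proof.
elim: bs => [|a bs IHbs] /=; first by exists [::], id.
case/andP=> /andP[a_gt1 a_even] bs_even; rewrite mulSn => ltT.
have [||s [rho [us prs sD szs covs]]] := IHbs; first by [].
  by apply: leq_ltn_trans ltT; rewrite leq_add2r leq_add2l leq_addl.
(* The count [3 ^ E] is requested because [e] is not known beforehand; only [3 ^ e.+1] of these
   primes are kept. *)
have [||e ltE lecount] := @pigeonhole_avoid (order_prime a) (D ++ s) E T (3 ^ E).
- exact: order_prime_inj.
- by rewrite size_cat; lia.
pose ps := take (3 ^ e.+1)
  [seq p <- [seq order_prime a e j | j <- iota 0 T] | [predC (D ++ s)] p].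
have leE : 3 ^ e.+1 <= 3 ^ E by rewrite leq_exp2l.
have szps : size ps = 3 ^ e.+1.
  by rewrite size_takel // size_filter (leq_trans leE).
have psP p : p \in ps -> [/\ p \notin D, p \notin s & exists2 j, j < T & p = order_prime a e j].
  move/mem_take; rewrite mem_filter /= mem_cat negb_or => /andP[/andP[-> ->]].
  by case/mapP=> j; rewrite mem_iota => ltj ->; split=> //; exists j.
have ups : uniq ps.
  rewrite take_uniq // filter_uniq // map_inj_uniq ?iota_uniq //.
  by move=> j j' /(order_prime_inj _ a_gt1 a_even)[].
have prps : all prime ps.
  by apply/allP => p /psP[_ _ [j _ ->]]; apply: order_prime_prime.
have ordb p : p \in ps -> (a ^ 2 ^ T.+1) ^ 3 ^ e.+1 = 1 %[mod p].
  case/psP=> _ _ [j ltj ->]; rewrite -expnM.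
  by rewrite order_prime_expn1 // dvdn_mul // dvdn_exp2l.
have m_gt0 : 0 < 3 ^ e.+1 by rewrite expn_gt0.
have [rho' cov'] := covering_residues _ _ _ m_gt0 ups prps szps ordb.
exists (ps ++ s), (fun p => if p \in ps then rho' p else rho p); split.
- rewrite cat_uniq ups us andbT /=; apply/hasPn => p ps_s.
  by apply/negP => /psP[_ /negP].
- by rewrite all_cat prps.
- by rewrite all_cat sD andbT; apply/allP => p /psP[].
- by rewrite size_cat szps leq_add.
move=> k Hk a'; rewrite inE => /predU1P[->|a'bs] q.
  have [|p pin pd] := cov' k _ q; last by exists p; rewrite ?mem_cat ?pin.
  by move=> p pin; rewrite Hk ?mem_cat ?pin.
have [|p pin pd] := covs k _ a' a'bs q; last by exists p; rewrite ?mem_cat ?pin ?orbT.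
move=> p pin; rewrite Hk ?mem_cat ?pin ?orbT //.
by case: ifP => // /psP[_ /negP].
Qed.

(** * Assembling the progression *)

Theorem theorem1p1 (A : nat) (hA : 2 <= A) :
  exists U V : nat,
    [/\ 0 < U, 0 < V &
      forall k : nat, arith_prog U V k ->
        odd k /\
        forall a n : nat, 2 <= a <= A -> 0 < n -> composite (k * a ^ n + 1)].
Proof.
pose bs := [seq a <- iota 2 A.-1 | ~~ odd a].
have bsE a : (a \in bs) = (1 < a <= A) && ~~ odd a.
  by rewrite mem_filter mem_iota andbC; congr (_ && _ && _); lia.
have bs_even : all (fun a => (1 < a) && ~~ odd a) bs.
  by apply/allP => a; rewrite bsE => /andP[/andP[->]].
have szbs : size bs <= A.
  by rewrite size_filter (leq_trans (count_size _ _)) // size_iota leq_pred.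
(* With [E = A.+1], it suffices that [A * T.+1 + 1 + (2 * A + 1) * M < A.+1 * T], that is
   [T > (2 * A + 1) * M + A + 1]. *)
pose M := 3 ^ A.+1; pose T := (A.*2.+1) * M + A.+2.
pose F := [seq pdiv (a ^ 2 ^ i + 1) | a <- bs, i <- iota 0 T.+1]; pose D := 2 :: F.
have szD : size D = (size bs * T.+1).+1 by congr _.+1; rewrite -/(size F) size_allpairs size_iota.
have prD : all prime D.
  apply/allP => p; rewrite inE => /predU1P[-> //|/allpairsP[[a i] /= [abs _ ->]]].
  apply: pdiv_prime; rewrite addn1 ltnS expn_gt0.
  by move: abs; rewrite bsE => /andP[/andP[/ltnW->]].
have [||s [rho [us prs sD _ covs]]] := @covering_primes A.+1 T D bs; first by [].
  rewrite szD -/M.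
  apply: (@leq_ltn_trans ((A * T.+1).+1 + A * M + A.+1 * M)).
    by rewrite !leq_add // ?ltnS leq_mul2r szbs orbT.
  by rewrite /T -mul2n; nia.
(* Distinct pairs in [F] may share a prime, as [2 ^ 2 + 1 = 4 + 1], hence [undup]. *)
have [||k0 Hk0] := @chinese_seq (undup D ++ s) (fun p => if p \in s then rho p else 1).
- rewrite cat_uniq undup_uniq us andbT; apply/hasPn => p /(allP sD).
  by apply: contra => pD; rewrite -mem_undup.
- by rewrite all_cat prs andbT; apply/allP => p; rewrite mem_undup; apply: (allP prD).
pose V := \prod_(p <- undup D ++ s) p.
have V_gt0 : 0 < V.
  rewrite /V big_seq prodn_cond_gt0 // => p; rewrite mem_cat mem_undup.
  by case/orP=> [/(allP prD)|/(allP prs)] /prime_gt0.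
have dvdV p : p \in undup D ++ s -> p %| V.
  by move=> pin; rewrite /V (big_rem p) //= dvdn_mulr.
(* The shift by [V] gives [p <= V <= k] for each prime [p] used, making it a proper divisor of
   [k * a ^ n + 1]. *)
exists (k0 + V), V; split=> //; first by rewrite addn_gt0 V_gt0 orbT.
move=> _ [m ->]; set k := _ + _.
have kV : V <= k by rewrite /k; nia.
have Hk p : p \in undup D ++ s -> k = (if p \in s then rho p else 1) %[mod p].
  move=> pin; rewrite -Hk0 // /k -addnA -modnDmr.
  have /eqP -> : p %| V + m * V by rewrite dvdn_add ?dvdn_mull ?dvdV.
  by rewrite addn0.
have Hs p : p \in s -> k = rho p %[mod p].
  by move=> pin; rewrite Hk ?pin // mem_cat pin orbT.
have HD p : p \in D -> k = 1 %[mod p].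
  move=> pin; rewrite Hk ?mem_cat ?mem_undup ?pin //.
  by case: ifP => // /(allP sD) /=; rewrite pin.
have k_odd : odd k by have := HD 2 (mem_head _ _); rewrite !modn2; case: (odd k).
split=> // a n /andP[a_ge2 leA] n_gt0.
have composite_dvd p : prime p -> p <= k -> p %| k * a ^ n + 1 -> composite (k * a ^ n + 1).
  move=> pp lepk pd; have p_gt1 := prime_gt1 pp.
  have lt_p : p < k * a ^ n + 1.
    by rewrite addn1 ltnS (leq_trans lepk) // leq_pmulr // expn_gt0 (ltnW a_ge2).
  rewrite /composite (ltn_trans p_gt1) //=; apply/negP => prk.
  by move: pd; rewrite dvdn_prime2 // => /eqP ep; rewrite -ep ltnn in lt_p.
have composite_in p : p \in undup D ++ s -> p %| k * a ^ n + 1 -> composite (k * a ^ n + 1).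
  move=> pin; apply: composite_dvd; last by rewrite (leq_trans _ kV) // dvdn_leq ?dvdV.
  by move: pin; rewrite mem_cat mem_undup => /orP[/(allP prD)|/(allP prs)].
have [a_odd|a_even] := boolP (odd a).
  apply: (composite_in 2); first by rewrite mem_cat mem_undup mem_head.
  by rewrite dvdn2 oddD oddM k_odd oddX a_odd orbT.
have abs : a \in bs by rewrite bsE a_ge2 leA.
have [Tn|] := boolP (2 ^ T.+1 %| n).
  have [p ps] := covs k Hs a abs (n %/ 2 ^ T.+1).
  by rewrite -expnM (mulnC (2 ^ _)) divnK //; apply: composite_in; rewrite mem_cat ps orbT.
rewrite pfactor_dvdn // -leqNgt => leT.
(* As [n = c * 2 ^ i] with [c] odd, [a ^ 2 ^ i + 1] divides [a ^ n + 1]. *)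
have [c co_c def_n] := pfactor_coprime (isT : prime 2) n_gt0.
have c_odd : odd c by rewrite -coprime2n.
move: leT def_n; move: (logn 2 n) => i lti def_n.
have fD : pdiv (a ^ 2 ^ i + 1) \in D.
  rewrite inE; apply/orP; right; apply/allpairsP.
  by exists (a, i); split=> //; rewrite mem_iota.
apply: (composite_in (pdiv (a ^ 2 ^ i + 1))); first by rewrite mem_cat mem_undup fD.
rewrite /dvdn -modnDml -modnMml HD // modnMml modnDml mul1n def_n mulnC expnM.
by rewrite -/(_ %| _) dvdn_expD1_odd // pdiv_dvd.
Qed.
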